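(* Let $L,m,n$ be positive integers with $m<L$. Let $A=[a(\theta_1),\dots,a(\theta_m)]\in\mathbb{C}^{L\times m}$ have linearly independent columns, let $D=[d_1,\dots,d_m]\in\mathbb{C}^{L\times m}$ with $d_i=\frac{d\,a(\theta_i)}{d\theta_i}$, and let $C\in\mathbb{C}^{L\times L}$ be Hermitian positive definite (noise spatial covariance). Let $\mathcal{P}\in\mathbb{C}^{nm\times nm}$ be a space-time signal covariance matrix (Hermitian positive semidefinite) with $m\times m$ blocks $\mathcal{P}^{ij}$, $1\le i,j\le n$, whose diagonal blocks are all equal to the spatial signal covariance matrix $P\in\mathbb{C}^{m\times m}$, i.e. $\mathcal{P}^{ii}=P$ for $i=1,\dots,n$. Let $\mathrm{CRB}^{\mathrm{det}}$, $\mathrm{CRB}^{\mathrm{iid}}$ and $\mathrm{CRB}^{\mathrm{cor}}$ be the $m\times m$ Cramér–Rao bound matrices for $\boldsymbol\theta=(\theta_1,\dots,\theta_m)$ in the deterministic, iid and temporally correlated signal models, as given by the formulas in the context (the inverses defining them being assumed to exist). Then $$\mathrm{CRB}^{\mathrm{det}}\;\le\;\mathrm{CRB}^{\mathrm{cor}}\;\le\;\mathrm{CRB}^{\mathrm{iid}},$$ where $X\le Y$ means that $Y-X$ is positive semidefinite.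
   Context: Setting: an array of $L$ sensors observes $n$ snapshots $x(t)=A s(t)+\nu(t)$, where $a(\theta)\in\mathbb{C}^L$ is a smooth steering vector, any set of $L$ steering vectors at distinct angles is linearly independent, and $\theta_1,\dots,\theta_m$ are distinct. The noise $\nu(t)$ is zero-mean Gaussian, temporally uncorrelated, with spatial covariance $C$. The models for the signal are: deterministic ($x(t)\sim\mathcal{N}(As(t),C)$); iid ($x(t)\sim\mathcal{N}(0,R)$, independent over $t$, with $R=APA^{\mathrm{H}}+C$ and $P=\mathrm{E}[s(t)s^{\mathrm{H}}(t)]$); temporally correlated ($\mathrm{vec}(X)\sim\mathcal{N}(0,\mathcal{R})$ with $X=[x(t_1),\dots,x(t_n)]$, $\mathcal{R}=\mathcal{A}\mathcal{P}\mathcal{A}^{\mathrm{H}}+\mathcal{C}$, $\mathcal{P}^{ij}=\mathrm{E}[s(t_i)s^{\mathrm{H}}(t_j)]$). Notation: $(\cdot)^{\mathrm{H}}$ is conjugate transpose, $(\cdot)^{\mathrm{T}}$ transpose, $\odot$ the entrywise (Hadamard) product, $\otimes$ the Kronecker product, $\Re$ the entrywise real part, $C^{-1/2}$ the Hermitian positive definite square root of $C^{-1}$. For an $nm\times nm$ matrix $\mathcal{M}$ partitioned into $m\times m$ blocks $\mathcal{M}^{ij}$, the block trace is $\mathrm{BTr}_m(\mathcal{M})=\sum_{i=1}^n\mathcal{M}^{ii}$. Put $\mathcal{A}=I_n\otimes A$, $\mathcal{C}=I_n\otimes C$, and $$\Pi_0^{\perp}=I-G(G^{\mathrm{H}}G)^{-1}G^{\mathrm{H}},\qquad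 G=C^{-1/2}A,\qquad H=\Re\big(D^{\mathrm{H}}C^{-1/2}\Pi_0^{\perp}C^{-1/2}D\big).$$ The Cramér–Rao bound matrices are $$\mathrm{CRB}^{\mathrm{det}}=\frac{1}{2n}\big[H\odot P^{\mathrm{T}}\big]^{-1},$$ $$\mathrm{CRB}^{\mathrm{iid}}=\frac{1}{2n}\big[H\odot(PA^{\mathrm{H}}R^{-1}AP)^{\mathrm{T}}\big]^{-1},\qquad R=APA^{\mathrm{H}}+C,$$ $$\mathrm{CRB}^{\mathrm{cor}}=\frac{1}{2}\big[H\odot \mathrm{BTr}_m(\mathcal{P}\mathcal{A}^{\mathrm{H}}\mathcal{R}^{-1}\mathcal{A}\mathcal{P})^{\mathrm{T}}\big]^{-1},\qquad \mathcal{R}=\mathcal{A}\mathcal{P}\mathcal{A}^{\mathrm{H}}+\mathcal{C}.$$ *)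

(* Defs.v *)
From HB Require Import structures.
From mathcomp Require Import all_boot all_order all_algebra.
From mathcomp Require Import all_classical all_reals all_analysis.
From mathcomp Require Import spectral complex mxtens.

Set Implicit Arguments.
Unset Strict Implicit.
Unset Printing Implicit Defensive.

Import Order.TTheory GRing.Theory Num.Theory.
Import numFieldNormedType.Exports.

Local Open Scope classical_set_scope.
Local Open Scope sesquilinear_scope.
Local Open Scope ring_scope.

Section HermitianMatrices.
Variable F : numClosedFieldType.

Definition psdmx (n : nat) (M : 'M[F]_n) : Prop :=
  M \is hermsymmx /\
  forall v : 'cV[F]_n, 0 <= (v^t* *m M *m v) ord0 ord0.

Definition posdefmx (n : nat) (M : 'M[F]_n) : Prop :=
  M \is hermsymmx /\
  forall v : 'cV[F]_n, v != 0 -> 0 < (v^t* *m M *m v) ord0 ord0.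

Definition lemx (n : nat) (X Y : 'M[F]_n) : Prop := psdmx (Y - X).

(* The Hermitian positive definite square root of C^-1; existence and
   uniqueness for positive definite C are proved in invsqrtmxP and
   invsqrtmx_unique below. *)
Definition invsqrtmx (n : nat) (C : 'M[F]_n) : 'M[F]_n :=
  xget 0 [set W : 'M[F]_n | posdefmx W /\ W *m W = invmx C].

Definition hadamardmx (m n : nat) (M N : 'M[F]_(m, n)) : 'M[F]_(m, n) :=
  map2_mx *%R M N.

(* Index mxtens_index (i, k) = i * m + k of 'I_(n * m) is position k of the
   i-th block, as in the Kronecker product _ *t _. *)
Definition blockmx (n m : nat) (M : 'M[F]_(n * m)) (i j : 'I_n) : 'M[F]_m :=
  \matrix_(k, l) M (mxtens_index (i, k)) (mxtens_index (j, l)).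

Definition blocktr (n m : nat) (M : 'M[F]_(n * m)) : 'M[F]_m :=
  \sum_(i < n) blockmx M i i.

Lemma hermsymE (n : nat) (M : 'M[F]_n) : (M \is hermsymmx) = (M == M^t*).
Proof. by rewrite qualifE /= expr0 scale1r. Qed.

Lemma posdefmx_sum_eq0 (n : nat) (V W E : 'M[F]_n) :
  posdefmx V -> posdefmx W -> E \is hermsymmx ->
  \tr (E *m V *m E) + \tr (E *m W *m E) = 0 -> E = 0.
Proof.
move=> [_ Vp] [_ Wp]; rewrite hermsymE => /eqP Eh; rewrite -mxtraceD => tr0.
have colE (M : 'M[F]_n) j :
    (E *m M *m E) j j = ((col j E)^t* *m M *m col j E) ord0 ord0.
  have rowE k : E j k = ((col j E)^t*) ord0 k by rewrite {1}Eh !mxE.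
  rewrite !mxE; apply: eq_bigr => k _; rewrite !mxE; congr (_ * _).
  by apply: eq_bigr => l _; rewrite rowE.
have Pge0 (M : 'M[F]_n) (x : 'cV[F]_n) :
    (forall v : 'cV[F]_n, v != 0 -> 0 < (v^t* *m M *m v) ord0 ord0) ->
    0 <= (x^t* *m M *m x) ord0 ord0.
  move=> Mp; have [->|/Mp/ltW//] := eqVneq x 0.
  by rewrite mulmx0 mxE.
have ge0 j : 0 <= (E *m V *m E + E *m W *m E) j j.
  by rewrite mxE addr_ge0 // colE Pge0.
suff col0 j : col j E = 0.
  by apply/matrixP => i j; move/matrixP: (col0 j) => /(_ i ord0); rewrite !mxE.
apply/eqP; apply: contraT => /[dup] /Vp + /Wp; rewrite -!colE => Vj Wj.
have : 0 < (E *m V *m E + E *m W *m E) j j.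
  by rewrite [X in 0 < X]mxE addr_gt0.
by rewrite (psumr_eq0P (fun j _ => ge0 j) tr0 isT) ltxx.
Qed.

Lemma invsqrtmx_unique (n : nat) (C V W : 'M[F]_n) :
  posdefmx V -> V *m V = invmx C -> posdefmx W -> W *m W = invmx C -> V = W.
Proof.
move=> Vp VV Wp WW; apply/eqP; rewrite -subr_eq0; apply/eqP.
have Eh : V - W \is hermsymmx.
  move: Vp.1 Wp.1; rewrite !hermsymE => /eqP Vh /eqP Wh.
  by apply/eqP; rewrite {1}Vh {1}Wh linearB /= map_mxB.
apply: (posdefmx_sum_eq0 Vp Wp Eh).
rewrite -(mulmxA _ V) mxtrace_mulC -mxtraceD -mulmxDl.
suff -> : V *m (V - W) + (V - W) *m W = 0 by rewrite mul0mx mxtrace0.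
by rewrite mulmxBr mulmxBl VV WW addrA subrK subrr.
Qed.

Lemma invsqrtmx_exists (n : nat) (C : 'M[F]_n) : posdefmx C ->
  exists W : 'M[F]_n, posdefmx W /\ W *m W = invmx C.
Proof.
move=> [Ch Cp]; set U := spectralmx C; set d := spectral_diag C.
have /hermitian_normalmx/orthomx_spectralP := Ch; rewrite -/U -/d => Ceq.
have Uu : U \in unitmx := spectral_unit C.
have Ui : invmx U = U^t* by rewrite invmx_unitary ?spectral_unitarymx.
have UUt : U *m U^t* = 1%:M by rewrite -Ui mulmxV.
have UtU : U^t* *m U = 1%:M by rewrite -Ui mulVmx.
have quad (e : 'rV[F]_n) (v : 'cV[F]_n) :
    (v^t* *m (U^t* *m diag_mx e *m U) *m v) ord0 ord0 =
    \sum_i e ord0 i * `|(U *m v) i ord0| ^+ 2.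
  have -> : v^t* *m (U^t* *m diag_mx e *m U) *m v =
            (U *m v)^t* *m diag_mx e *m (U *m v).
    by rewrite trmx_mul map_mxM !mulmxA.
  move: (U *m v) => y; rewrite mul_mx_diag mxE; apply: eq_bigr => i _.
  by rewrite !mxE normCK mulrAC mulrC [y i ord0 * _]mulrC.
have d_gt0 i : 0 < d ord0 i.
  pose v : 'cV[F]_n := U^t* *m delta_mx i ord0.
  have Uv : U *m v = delta_mx i ord0 by rewrite mulmxA UUt mul1mx.
  have v0 : v != 0.
    apply/eqP => v0; move: Uv; rewrite v0 mulmx0 => /matrixP/(_ i ord0).
    by rewrite !mxE !eqxx => /esym/eqP; rewrite oner_eq0.
  have := Cp v v0; rewrite Ceq Ui quad Uv (bigD1 i) //= big1 => [|j ji].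
    by rewrite addr0 mxE !eqxx normr1 expr1n mulr1.
  by rewrite mxE (negPf ji) normr0 expr0n mulr0.
pose e : 'rV[F]_n := \row_i (sqrtC (d ord0 i))^-1.
have e_gt0 i : 0 < e ord0 i by rewrite mxE invr_gt0 sqrtC_gt0.
exists (U^t* *m diag_mx e *m U); split; first split.
- rewrite hermsymE !trmx_mul !map_mxM /= trmxCK tr_diag_mx map_diag_mx mulmxA.
  have -> : map_mx Num.conj e = e.
    by apply/rowP => i; rewrite mxE; apply/CrealP/gtr0_real/e_gt0.
  by [].
- move=> v v0; rewrite quad lt_def sumr_ge0 ?andbT => [|i _]; last first.
    by rewrite mulr_ge0 ?exprn_ge0 // ltW.
  apply: contraNneq v0 => s0.
  rewrite -[v]mul1mx -UtU -mulmxA.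
  suff -> : U *m v = 0 by rewrite mulmx0.
  apply/colP => i; rewrite [RHS]mxE.
  have := psumr_eq0P (fun i _ => mulr_ge0 (ltW (e_gt0 i))
            (exprn_ge0 2 (normr_ge0 ((U *m v) i ord0)))) s0 (i := i) isT.
  by move/eqP; rewrite mulf_eq0 gt_eqF //= sqrf_eq0 normr_eq0 => /eqP.
have -> : U^t* *m diag_mx e *m U *m (U^t* *m diag_mx e *m U) =
          U^t* *m (diag_mx e *m diag_mx e) *m U.
  by rewrite !mulmxA -(mulmxA _ U) UUt mulmx1.
set W := _ *m U.
have WC : W *m C = 1%:M.
  rewrite Ceq Ui /W !mulmxA -(mulmxA _ U) UUt mulmx1.
  rewrite -(mulmxA (U^t*) (diag_mx e)) -(mulmxA (U^t*) _ (diag_mx d)).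
  suff -> : diag_mx e *m diag_mx e *m diag_mx d = 1%:M.
    by rewrite mulmx1 UtU.
  rewrite !mulmx_diag -diag_const_mx; congr diag_mx; apply/rowP => i.
  rewrite !mxE -expr2 exprVn sqrtCK mulVf // gt_eqF //.
by have [_ Cu] := mulmx1_unit WC; rewrite -[LHS]mulmx1 -(mulmxV Cu) mulmxA WC mul1mx.
Qed.

Lemma invsqrtmxP (n : nat) (C : 'M[F]_n) : posdefmx C ->
  posdefmx (invsqrtmx C) /\ invsqrtmx C *m invsqrtmx C = invmx C.
Proof.
by move=> /invsqrtmx_exists Wex; exact: (xgetPex (0 : 'M[F]_n) Wex).
Qed.

End HermitianMatrices.

Section CramerRaoBounds.
Variables (F : numClosedFieldType) (L m : nat).
Implicit Types (A D : 'M[F]_(L, m)) (C : 'M[F]_L) (P : 'M[F]_m).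

(* The projection written Pi_0^perp. *)
Definition noiseproj A C : 'M[F]_L :=
  let G := invsqrtmx C *m A in
  1%:M - G *m invmx (G^t* *m G) *m G^t*.

Definition Hmx A D C : 'M[F]_m :=
  map_mx (fun z : F => 'Re z)
    (D^t* *m invsqrtmx C *m noiseproj A C *m invsqrtmx C *m D).

Definition Rmx A C P : 'M[F]_L := A *m P *m A^t* + C.

(* The prefix st marks the space-time (script letter) matrices. *)
Definition stA (n : nat) A : 'M[F]_(n * L, n * m) := (1%:M : 'M[F]_n) *t A.

Definition stC (n : nat) C : 'M[F]_(n * L) := (1%:M : 'M[F]_n) *t C.

Definition stR (n : nat) A C (PP : 'M[F]_(n * m)) : 'M[F]_(n * L) :=
  stA n A *m PP *m (stA n A)^t* + stC n C.

Definition infodet A D C P : 'M[F]_m := hadamardmx (Hmx A D C) P^T.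

Definition infoiid A D C P : 'M[F]_m :=
  hadamardmx (Hmx A D C) (P *m A^t* *m invmx (Rmx A C P) *m A *m P)^T.

Definition infocor (n : nat) A D C (PP : 'M[F]_(n * m)) : 'M[F]_m :=
  hadamardmx (Hmx A D C)
    (blocktr (PP *m (stA n A)^t* *m invmx (stR A C PP) *m stA n A *m PP))^T.

Definition CRBdet (n : nat) A D C P : 'M[F]_m :=
  (2 * n%:R)^-1 *: invmx (infodet A D C P).

Definition CRBiid (n : nat) A D C P : 'M[F]_m :=
  (2 * n%:R)^-1 *: invmx (infoiid A D C P).

Definition CRBcor (n : nat) A D C (PP : 'M[F]_(n * m)) : 'M[F]_m :=
  2^-1 *: invmx (infocor A D C PP).

End CramerRaoBounds.

Section SteeringVectors.
Variables (R : realType) (L m : nat).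
Implicit Types (a : R -> 'cV[R[i]]_L) (theta : 'I_m -> R).

(* A function of a real variable with values in C^L is differentiated through
   the real and imaginary parts of its coordinates. *)
Definition coordRe a (l : 'I_L) : R -> R := fun t => complex.Re (a t l ord0).

Definition coordIm a (l : 'I_L) : R -> R := fun t => complex.Im (a t l ord0).

Definition smooth_on (Theta : set R) a : Prop :=
  forall (l : 'I_L) (k : nat) (t : R), Theta t ->
    derivable ((coordRe a l)^`(k)%classic) t 1 /\ derivable ((coordIm a l)^`(k)%classic) t 1.

Definition steering_deriv a (t : R) : 'cV[R[i]]_L :=
  \col_l Complex ((coordRe a l)^`()%classic t) ((coordIm a l)^`()%classic t).

Definition steeringmx a theta : 'M[R[i]]_(L, m) :=
  \matrix_(l, i) a (theta i) l ord0.

Definition dsteeringmx a theta : 'M[R[i]]_(L, m) :=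
  \matrix_(l, i) steering_deriv a (theta i) l ord0.

End SteeringVectors.

(* Main.v *)
(* Write f(P) = P A^H R^-1 A P. The difference P - f(P) is the error covariance
   of the best linear estimator of the signal, so it is positive semidefinite;
   applied to the space-time model this gives BTr f(PP) <= n P. The estimator of
   s(t_i) from the single snapshot x(t_i) is no better than the one using all
   snapshots, so each diagonal block of f(PP) dominates f(P) and
   n f(P) <= BTr f(PP). Since H is the real part of a Gram matrix, the Schur
   product theorem transports both inequalities to the information matrices, and
   matrix inversion reverses them. *)

Require Import Defs.
From HB Require Import structures.
From mathcomp Require Import all_boot all_order all_algebra.
From mathcomp Require Import all_classical all_reals all_analysis.
From mathcomp Require Import spectral complex mxtens.

Set Implicit Arguments.
Unset Strict Implicit.
Unset Printing Implicit Defensive.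

Import Order.TTheory GRing.Theory Num.Theory.
Import numFieldNormedType.Exports.

Local Open Scope classical_set_scope.
Local Open Scope ring_scope.

(** * Positive semidefinite matrices: congruence, inversion and Schur products *)

Section PositiveSemidefinite.
Local Open Scope sesquilinear_scope.
Variable F : numClosedFieldType.

Lemma adjmxM m n p (A : 'M[F]_(m, n)) (B : 'M[F]_(n, p)) :
  (A *m B)^t* = B^t* *m A^t*.
Proof. by rewrite trmx_mul map_mxM. Qed.

Lemma adjmxD m n (A B : 'M[F]_(m, n)) : (A + B)^t* = A^t* + B^t*.
Proof. by rewrite linearD /= map_mxD. Qed.

Lemma adjmxB m n (A B : 'M[F]_(m, n)) : (A - B)^t* = A^t* - B^t*.
Proof. by rewrite linearB /= map_mxB. Qed.

Lemma adjmx1 n : (1%:M : 'M[F]_n)^t* = 1%:M.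
Proof. by rewrite trmx1 map_mx1. Qed.

Lemma adjmx_inv n (A : 'M[F]_n) : (invmx A)^t* = invmx (A^t*).
Proof. by rewrite trmx_inv map_invmx. Qed.

Lemma psdmx_adj n (M : 'M[F]_n) : psdmx M -> M^t* = M.
Proof. by case; rewrite hermsymE => /eqP. Qed.

Lemma posdefmx_adj n (M : 'M[F]_n) : posdefmx M -> M^t* = M.
Proof. by case; rewrite hermsymE => /eqP. Qed.

Lemma psdmxD n (M N : 'M[F]_n) : psdmx M -> psdmx N -> psdmx (M + N).
Proof.
move=> pM pN; split=> [|v].
  by rewrite hermsymE adjmxD !psdmx_adj.
by rewrite mulmxDr mulmxDl mxE addr_ge0 //; [case: pM | case: pN].
Qed.

Lemma psdmx0 n : psdmx (0 : 'M[F]_n).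
Proof.
by split=> [|v]; rewrite ?hermsymE ?mulmx0 ?mul0mx ?mxE ?trmx0 ?map_mx0.
Qed.

Lemma psdmx_sum n (I : finType) (M : I -> 'M[F]_n) :
  (forall i, psdmx (M i)) -> psdmx (\sum_i M i).
Proof.
move=> pM; elim/big_rec: _ => [|i N _]; last exact: psdmxD.
by split=> [|v]; rewrite ?hermsymE ?mulmx0 ?mul0mx ?mxE ?trmx0 ?map_mx0.
Qed.

Lemma psdmxZ n (c : F) (M : 'M[F]_n) : 0 <= c -> psdmx M -> psdmx (c *: M).
Proof.
move=> c0 pM; split=> [|v].
  rewrite hermsymE linearZ /= map_mxZ psdmx_adj //.
  by rewrite /= (CrealP (ger0_real c0)).
by rewrite -scalemxAr -scalemxAl mxE mulr_ge0 //; case: pM.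
Qed.

Lemma lemxZ n (c : F) (X Y : 'M[F]_n) :
  0 <= c -> lemx X Y -> lemx (c *: X) (c *: Y).
Proof. by rewrite /lemx -scalerBr; apply: psdmxZ. Qed.

Lemma psdmx_congr m n (K : 'M[F]_(m, n)) (M : 'M[F]_n) :
  psdmx M -> psdmx (K *m M *m K^t*).
Proof.
move=> pM; split=> [|v].
  by rewrite hermsymE !adjmxM trmxCK psdmx_adj // mulmxA.
have -> : v^t* *m (K *m M *m K^t*) *m v = (K^t* *m v)^t* *m M *m (K^t* *m v).
  by rewrite adjmxM trmxCK !mulmxA.
by case: pM.
Qed.

Lemma adjmx_sqr_ge0 n (v : 'cV[F]_n) : 0 <= (v^t* *m v) ord0 ord0.
Proof.
rewrite mxE sumr_ge0 // => i _.
by rewrite !mxE mulrC -normCK exprn_ge0.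
Qed.

Lemma psdmx1 n : psdmx (1%:M : 'M[F]_n).
Proof.
by split=> [|v]; rewrite ?hermsymE ?adjmx1 // mulmx1 adjmx_sqr_ge0.
Qed.

Lemma psdmx_gram m n (K : 'M[F]_(m, n)) : psdmx (K *m K^t*).
Proof. by rewrite -{1}[K]mulmx1; apply/psdmx_congr/psdmx1. Qed.

Lemma adjmx_sqr_eq0 n (v : 'cV[F]_n) :
  (v^t* *m v) ord0 ord0 = 0 -> v = 0.
Proof.
rewrite mxE => v0; apply/colP => i; rewrite [RHS]mxE.
have ge0 j : true -> 0 <= v^t* ord0 j * v j ord0.
  by move=> _; rewrite !mxE mulrC -normCK exprn_ge0.
have := psumr_eq0P ge0 v0 (i := i) isT.
rewrite !mxE mulrC -normCK => /eqP.
by rewrite sqrf_eq0 normr_eq0 => /eqP.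
Qed.

(** If [u] kills the sum, then [u N u^H] and the squared norm of [B^H u^H] are nonnegative with sum
    zero, so [u B = 0] and [u = 0]. The case [N = 0] covers Gram matrices; the general case covers
    signal plus noise covariances. *)
Lemma psdD_gram_unit m n (N : 'M[F]_n) (B : 'M[F]_(n, m)) :
  psdmx N -> row_free B -> N + B *m B^t* \in unitmx.
Proof.
move=> [_ pN] Bfree; rewrite -row_free_unit; apply: inj_row_free => u uM0.
set w : 'cV_m := B^t* *m u^t*.
have := pN (u^t*); rewrite trmxCK.
have : (u *m N *m u^t*) ord0 ord0 + (w^t* *m w) ord0 ord0 = 0.
  have -> : w^t* *m w = u *m (B *m B^t*) *m u^t*.
    by rewrite adjmxM !trmxCK !mulmxA.
  move: uM0 => /(congr1 (fun M => (M *m u^t*) ord0 ord0)).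
  by rewrite mulmxDr mulmxDl mul0mx mxE => ->; rewrite mxE.
move=> /eqP + q0; rewrite paddr_eq0 ?adjmx_sqr_ge0 // => /andP[_ /eqP].
move/adjmx_sqr_eq0 => /(congr1 (fun M => M^t*)).
rewrite adjmxM !trmxCK trmx0 map_mx0 => uB0.
by apply: (row_free_inj Bfree); rewrite uB0 mul0mx.
Qed.

Lemma posdefmx_unit n (M : 'M[F]_n) : posdefmx M -> M \in unitmx.
Proof.
move=> [_ pM]; rewrite -row_free_unit; apply: inj_row_free => u uM0.
apply/eqP; apply: contraT => u0.
have /pM : u^t* != 0.
  apply: contraNneq u0 => /(congr1 (fun M => M^t*)).
  by rewrite trmxCK trmx0 map_mx0 => ->.
by rewrite trmxCK uM0 mul0mx mxE ltxx.
Qed.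

(* With [E = Y - X], [X^-1 - Y^-1 = Y^-1 (E + E X^-1 E) Y^-1]. *)
Lemma lemx_inv n (X Y : 'M[F]_n) : psdmx X -> lemx X Y ->
  X \in unitmx -> Y \in unitmx -> lemx (invmx Y) (invmx X).
Proof.
rewrite /lemx => pX; set E := Y - X => pE Xu Yu.
have YE : Y = X + E by rewrite addrC subrK.
clearbody E.
have pY : psdmx Y by rewrite YE; apply: psdmxD.
(* Writing [X^-1] as [X^-1 X X^-1] exhibits it as a congruence of [X], so its positivity comes from
   that of [X]. *)
have -> : invmx X - invmx Y =
    invmx Y *m (E + E *m (invmx X *m X *m invmx X) *m E) *m invmx Y.
  have -> : E + E *m (invmx X *m X *m invmx X) *m E = Y *m invmx X *m Y - Y.
    rewrite mulVmx // mul1mx [in RHS]YE mulmxDl mulmxV // mulmxDl mul1mx.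
    by rewrite mulmxDr mulmxKV // addrAC subrr add0r.
  rewrite mulmxBr mulmxBl !mulmxA mulVmx // mul1mx.
  by rewrite -mulmxA mulmxV // mulmx1 mul1mx.
have {2}-> : invmx Y = (invmx Y)^t* by rewrite adjmx_inv psdmx_adj.
apply: psdmx_congr; apply: psdmxD => //.
have {2}-> : E = E^t* by rewrite psdmx_adj.
apply: psdmx_congr.
have {2}-> : invmx X = (invmx X)^t* by rewrite adjmx_inv psdmx_adj.
exact: psdmx_congr.
Qed.

(** The quadratic form of [M^T] at [v] is a scalar, hence its own transpose, which is the form of
    [M] at the conjugate of [v]. *)
Lemma psdmx_tr n (M : 'M[F]_n) : psdmx M -> psdmx M^T.
Proof.
move=> pM; split=> [|v].
  by rewrite hermsymE trmxK -{1}(psdmx_adj pM) -map_trmx trmxK.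
have -> : v^t* *m M^T *m v = ((map_mx Num.conj v)^t* *m M *m map_mx Num.conj v)^T.
  rewrite !trmx_mul -!map_trmx trmxK mulmxA; congr (_ *m _ *m _).
  by rewrite -map_mx_comp map_mx_id // => x; rewrite /= conjCK.
by rewrite mxE; case: pM.
Qed.

Lemma hadamardmxZr m (c : F) (H N : 'M[F]_m) :
  hadamardmx H (c *: N)^T = c *: hadamardmx H N^T.
Proof. by apply/matrixP => i j; rewrite !mxE mulrCA. Qed.

(* Schur product theorem for a factored matrix:
   [(B^H B) o N = \sum_p diag(B_p)^H N diag(B_p)], [B_p] the rows of [B]. *)
Lemma psdmx_hadamard_gram m n (B : 'M[F]_(m, n)) (N : 'M[F]_n) :
  psdmx N -> psdmx (hadamardmx (B^t* *m B) N).
Proof.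
move=> pN; pose K p := (diag_mx (row p B))^t*.
have -> : hadamardmx (B^t* *m B) N = \sum_p K p *m N *m (K p)^t*.
  apply/matrixP => k l; rewrite summxE !mxE mulr_suml.
  apply: eq_bigr => p _.
  rewrite /K trmxCK tr_diag_mx map_diag_mx mul_mx_diag mul_diag_mx !mxE.
  by rewrite mulrAC.
by apply: psdmx_sum => p; apply: psdmx_congr.
Qed.

(** The real part of the Gram matrix of [B] is the mean of the Gram matrices of [B] and of its
    conjugate [Bc], so the factored Schur theorem applies to each half. *)
Lemma psdmx_hadamard_Re m n (B : 'M[F]_(m, n)) (N : 'M[F]_n) : psdmx N ->
  psdmx (hadamardmx (map_mx (fun z : F => 'Re z) (B^t* *m B)) N).
Proof.
move=> pN; set Bc := map_mx Num.conj B.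
have -> : hadamardmx (map_mx (fun z : F => 'Re z) (B^t* *m B)) N =
   2^-1 *: (hadamardmx (B^t* *m B) N + hadamardmx (Bc^t* *m Bc) N).
  have -> : Bc^t* *m Bc = map_mx Num.conj (B^t* *m B).
    by rewrite map_mxM /Bc [in LHS]map_trmx.
  apply/matrixP => k l; move: (B^t* *m B) => M; rewrite !mxE /= ReE.
  by rewrite -mulrDl mulrA [_^-1 * _]mulrC.
apply: psdmxZ; first by rewrite invr_ge0 ler0n.
by apply: psdmxD; apply: psdmx_hadamard_gram.
Qed.

End PositiveSemidefinite.

(** * Diagonal blocks as congruences by selection matrices *)

Section BlockSelection.
Local Open Scope sesquilinear_scope.
Variables (F : numClosedFieldType) (n : nat).

(** This is the Kronecker product of the [i]-th unit row vector with [I_p]. It picks time [i] out of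
    a stacked vector, of signals for [p = m] and of snapshots for [p = L]. *)
Definition blocksel (p : nat) (i : 'I_n) : 'M[F]_(p, n * p) :=
  rowsub (fun k => mxtens_index (i, k)) 1%:M.

Lemma blockselE p i (M : 'M[F]_(n * p)) :
  blocksel p i *m M *m (blocksel p i)^t* = blockmx M i i.
Proof.
(* Transposing turns the column selection into a second row selection; the selector has entries 0
   and 1, so conjugation fixes it. *)
rewrite /blocksel mul_rowsub_mx mul1mx -[_^t*]trmxK -[LHS]trmxK trmx_mul trmxK.
have -> : ((rowsub (fun k => mxtens_index (i, k)) (1%:M : 'M[F]_(n * p)))^t*)^T =
   rowsub (fun k => mxtens_index (i, k)) 1%:M.
  apply/matrixP => k l; rewrite !mxE; case: eqP => _; exact: rmorph_nat.
by rewrite mul_rowsub_mx mul1mx; apply/matrixP => k l; rewrite !mxE.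
Qed.

(** The array acts on each snapshot separately, so selecting a time commutes with it. *)
Lemma blocksel_stA L m i (A : 'M[F]_(L, m)) :
  blocksel L i *m stA n A = A *m blocksel m i.
Proof.
rewrite /blocksel mul_rowsub_mx mul1mx; apply/matrixP => k l.
case: (mxtens_indexP l) => j q; rewrite mxE /stA tensmxE !mxE.
rewrite (bigD1 q) //= big1 => [|r rq]; last first.
  rewrite !mxE (can_eq (@mxtens_indexK _ _)) xpair_eqE (negPf rq) andbF.
  by rewrite mulr0.
rewrite addr0 !mxE (can_eq (@mxtens_indexK _ _)) xpair_eqE eqxx andbT.
by rewrite mulrC.
Qed.

Lemma blockmx_stC L i (C : 'M[F]_L) : blockmx (stC n C) i i = C.
Proof. by apply/matrixP => k l; rewrite mxE tensmxE !mxE eqxx mul1r. Qed.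

(** The marginal law of one snapshot in the correlated model is that of the iid model. *)
Lemma blocksel_stR L m i (A : 'M[F]_(L, m)) C (PP : 'M[F]_(n * m)) :
  blocksel L i *m stR A C PP *m (blocksel L i)^t* = Rmx A C (blockmx PP i i).
Proof.
rewrite /stR mulmxDr mulmxDl [X in _ + X]blockselE blockmx_stC; congr (_ + _).
rewrite !mulmxA blocksel_stA -!mulmxA -adjmxM blocksel_stA adjmxM !mulmxA.
by rewrite -blockselE !mulmxA.
Qed.

Lemma lemx_blocktr m (M : 'M[F]_(n * m)) (X : 'M[F]_m) :
  (forall i, lemx X (blockmx M i i)) -> lemx (n%:R *: X) (blocktr M).
Proof.
move=> leX; rewrite /lemx /blocktr scaler_nat -[X in _ *+ X]card_ord.
by rewrite -sumr_const -sumrB; apply: psdmx_sum.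
Qed.

Lemma blocktr_lemx m (M : 'M[F]_(n * m)) (X : 'M[F]_m) :
  (forall i, lemx (blockmx M i i) X) -> lemx (blocktr M) (n%:R *: X).
Proof.
move=> leX; rewrite /lemx /blocktr scaler_nat -[X in _ *+ X]card_ord.
by rewrite -sumr_const -sumrB; apply: psdmx_sum.
Qed.

End BlockSelection.

(** * Covariance of the linear signal estimate, bounded by the signal covariance *)

Section InformationOrder.
Local Open Scope sesquilinear_scope.
Variables (F : numClosedFieldType) (L m : nat).
Implicit Types (A : 'M[F]_(L, m)) (P : 'M[F]_m) (C : 'M[F]_L).

(** For [R = Rmx A C P] this is the covariance of the best linear estimate of the signal. Keeping
    [R] as an argument lets the same formula serve the space-time matrices [stA] and [stR]. *)
Definition signalinfo A P R : 'M[F]_m :=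
  P *m A^t* *m invmx R *m A *m P.

(** It equals [K R K^H] with [K = P A^H R^-1]. *)
Lemma signalinfo_psd A P R :
  psdmx P -> psdmx R -> R \in unitmx -> psdmx (signalinfo A P R).
Proof.
move=> pP pR Ru.
have -> : signalinfo A P R =
    (P *m A^t* *m invmx R) *m R *m (P *m A^t* *m invmx R)^t*.
  rewrite !adjmxM trmxCK adjmx_inv (psdmx_adj pP) (psdmx_adj pR).
  by rewrite mulmxKV // !mulmxA.
exact: psdmx_congr.
Qed.

(* [P - P A^H R^-1 A P] is the error covariance of the linear estimator
   [K = P A^H R^-1], written in Joseph form. *)
Lemma signalinfo_le A P C : psdmx P -> psdmx C -> Rmx A C P \in unitmx ->
  lemx (signalinfo A P (Rmx A C P)) P.
Proof.
move=> pP pC; rewrite /lemx /signalinfo; set R := Rmx A C P => Ru.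
have pR : psdmx R by apply: psdmxD => //; apply: psdmx_congr.
set K := P *m A^t* *m invmx R.
have KR : K *m R = P *m A^t* by rewrite mulmxKV.
have CE : C = R - A *m P *m A^t* by rewrite /R /Rmx addrAC subrr add0r.
have -> : P - K *m A *m P =
    (1%:M - K *m A) *m P *m (1%:M - K *m A)^t* + K *m C *m K^t*.
  rewrite {1}CE adjmxB adjmx1 adjmxM mulmxBr mulmx1 !mulmxBl mul1mx.
  rewrite mulmxBr mulmxBl KR !mulmxA opprB addrA addrAC.
  by rewrite [in RHS]addrA [X in _ = X + _]addrAC addrK subrK.
by apply: psdmxD; apply: psdmx_congr.
Qed.

End InformationOrder.

(** * One snapshot against all snapshots *)

Section BlockInformation.
Local Open Scope sesquilinear_scope.
Variables (F : numClosedFieldType) (L m : nat).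

(* The difference is [(K - K0) RR (K - K0)^H], where [K0] is the optimal
   space-time estimator of the signal at time [i] and [K] the optimal estimator
   using the snapshot at time [i] only. *)
Lemma signalinfo_block_ge n (A : 'M[F]_(L, m)) (C : 'M[F]_L)
    (PP : 'M[F]_(n * m)) (i : 'I_n) :
  psdmx PP -> psdmx C -> Rmx A C (blockmx PP i i) \in unitmx ->
  psdmx (stR A C PP) -> stR A C PP \in unitmx ->
  lemx (signalinfo A (blockmx PP i i) (Rmx A C (blockmx PP i i)))
       (blockmx (signalinfo (stA n A) PP (stR A C PP)) i i).
Proof.
move=> pPP pC; set P := blockmx PP i i; set R := Rmx A C P; set RR := stR A C PP.
move=> Ru pRR RRu.
have PE : P = blocksel F m i *m PP *m (blocksel F m i)^t* by rewrite blockselE.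
have pP : psdmx P by rewrite PE; apply: psdmx_congr.
have pR : psdmx R by apply: psdmxD => //; apply: psdmx_congr.
pose K := P *m A^t* *m invmx R *m blocksel F L i.
(* [B] is the cross-covariance of the signal at time [i] with all snapshots, so the optimal
   estimator [K0] is [B RR^-1]. Below, [K B^H], [B K^H] and [K RR K^H] all collapse to the
   single-snapshot [signalinfo A P R]. *)
pose B := blocksel F m i *m PP *m (stA n A)^t*.
have SB : blocksel F L i *m B^t* = A *m P.
  rewrite /B !adjmxM trmxCK (psdmx_adj pPP) !mulmxA blocksel_stA.
  by rewrite PE !mulmxA.
have BS : B *m (blocksel F L i)^t* = P *m A^t*.
  by rewrite -[B]trmxCK -adjmxM SB adjmxM psdmx_adj.
have KB : K *m B^t* = signalinfo A P R by rewrite /K -mulmxA SB !mulmxA.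
have BK : B *m K^t* = signalinfo A P R.
  rewrite /K !adjmxM trmxCK !mulmxA BS adjmx_inv (psdmx_adj pP) (psdmx_adj pR).
  by [].
have KRK : K *m RR *m K^t* = signalinfo A P R.
  have -> : K *m RR *m K^t* = (P *m A^t* *m invmx R) *m
      (blocksel F L i *m RR *m (blocksel F L i)^t*) *m (P *m A^t* *m invmx R)^t*.
    by rewrite /K adjmxM !mulmxA.
  rewrite blocksel_stR -/P -/R mulmxKV // !adjmxM trmxCK adjmx_inv.
  by rewrite (psdmx_adj pP) (psdmx_adj pR) !mulmxA.
have -> : blockmx (signalinfo (stA n A) PP RR) i i = B *m invmx RR *m B^t*.
  rewrite -blockselE /signalinfo /B !adjmxM trmxCK (psdmx_adj pPP).
  by rewrite !mulmxA.
clearbody K B; rewrite /lemx.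
have -> : B *m invmx RR *m B^t* - signalinfo A P R =
   (K - B *m invmx RR) *m RR *m (K - B *m invmx RR)^t*.
  rewrite mulmxBl mulmxKV // adjmxB mulmxBr !mulmxBl KRK adjmxM adjmx_inv.
  rewrite (psdmx_adj pRR) BK !mulmxA mulmxK // KB subrr sub0r.
  by rewrite opprB.
exact: psdmx_congr.
Qed.

End BlockInformation.

(** * Order of the information matrices and of their inverses *)

Section CRBOrder.
Local Open Scope sesquilinear_scope.
Variables (F : numClosedFieldType) (L m n : nat).
Variables (A D : 'M[F]_(L, m)) (C : 'M[F]_L) (PP : 'M[F]_(n * m)) (P : 'M[F]_m).
Hypotheses (n_gt0 : (0 < n)%N) (A_free : row_free A^T).
Hypotheses (C_posdef : posdefmx C) (PP_psd : psdmx PP).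
Hypothesis PP_diag : forall i : 'I_n, blockmx PP i i = P.

(** The projection [Pi] is Hermitian and idempotent and [W] is Hermitian, so [B = Pi W D] is a
    factor. *)
Lemma Hmx_gramE : exists B : 'M[F]_(L, m),
  Hmx A D C = map_mx (fun z : F => 'Re z) (B^t* *m B).
Proof.
have [W_posdef _] := invsqrtmxP C_posdef.
rewrite /Hmx /noiseproj; set W := invsqrtmx C in W_posdef *.
have Wh : W^t* = W := posdefmx_adj W_posdef.
set G := W *m A; set Pi := 1%:M - _.
have GG_unit : G^t* *m G \in unitmx.
  (* With [N = 0], only row freeness of [G^H = A^H W] is left: [W] is invertible and conjugation
     preserves the rank of [A^T]. *)
  have := psdD_gram_unit (psdmx0 F m) (B := G^t*).
  rewrite trmxCK add0r; apply.
  rewrite /G adjmxM Wh /row_free mxrankMfree ?row_free_unit ?posdefmx_unit //.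
  by rewrite mxrank_map.
clearbody G.
have Pih : Pi^t* = Pi.
  by rewrite /Pi adjmxB adjmx1 !adjmxM trmxCK adjmx_inv adjmxM trmxCK mulmxA.
have PiPi : Pi *m Pi = Pi.
  rewrite {2}/Pi mulmxBr mulmx1 [X in _ - X](_ : _ = 0) ?subr0 //.
  rewrite !mulmxA /Pi mulmxBl mul1mx -(mulmxA (G *m _)) mulmxKV //.
  by rewrite subrr !mul0mx.
exists (Pi *m W *m D); congr map_mx.
by rewrite !adjmxM Pih Wh !mulmxA -(mulmxA _ Pi Pi) PiPi.
Qed.

Lemma Hmx_hadamard_psd (N : 'M[F]_m) :
  psdmx N -> psdmx (hadamardmx (Hmx A D C) N^T).
Proof. by move=> pN; have [B ->] := Hmx_gramE; apply/psdmx_hadamard_Re/psdmx_tr. Qed.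

Lemma Hmx_hadamard_le (M N : 'M[F]_m) : lemx M N ->
  lemx (hadamardmx (Hmx A D C) M^T) (hadamardmx (Hmx A D C) N^T).
Proof.
move=> /Hmx_hadamard_psd; rewrite /lemx.
congr psdmx; apply/matrixP => i j.
by rewrite !mxE mulrBr.
Qed.

(** The factor is the inverse of [invsqrtmx C]. This form feeds [psdD_gram_unit] and passes to [stC]
    by tensoring [B] with the identity. *)
Lemma noise_gram : exists2 B : 'M[F]_L, B \in unitmx & C = B *m B^t*.
Proof.
have [W_posdef WW] := invsqrtmxP C_posdef.
exists (invmx (invsqrtmx C)); first by rewrite unitmx_inv posdefmx_unit.
have Wu := posdefmx_unit W_posdef.
have WWC : invsqrtmx C *m (invsqrtmx C *m C) = 1%:M.
  by rewrite mulmxA WW mulVmx // posdefmx_unit.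
rewrite adjmx_inv (posdefmx_adj W_posdef) -[RHS]mulmx1 -WWC.
by rewrite !mulmxA mulmxKV // mulVmx // mul1mx.
Qed.

Lemma P_psd : psdmx P.
Proof.
(* Since [n] is positive there is a first block, and it equals [P]. *)
by rewrite -(PP_diag (Ordinal n_gt0)) -blockselE; apply: psdmx_congr.
Qed.

Lemma C_psd : psdmx C.
Proof. by have [B _ ->] := noise_gram; apply: psdmx_gram. Qed.

Lemma Rmx_psd : psdmx (Rmx A C P).
Proof. by apply: psdmxD C_psd; apply/psdmx_congr/P_psd. Qed.

Lemma Rmx_unit : Rmx A C P \in unitmx.
Proof.
have [B Bu ->] := noise_gram.
by apply: psdD_gram_unit; [apply/psdmx_congr/P_psd | rewrite row_free_unit].
Qed.

Lemma stC_gram : (0 < L)%N ->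
  exists2 B : 'M[F]_(n * L), B \in unitmx & stC n C = B *m B^t*.
Proof.
move=> L_gt0; have [B Bu CE] := noise_gram; exists (1%:M *t B).
  by apply: tensmx_unit; rewrite -?lt0n ?unitmx1.
by rewrite trmx_tens map_mxT tensmx_mul adjmx1 mulmx1 -CE.
Qed.

Lemma stR_psd : (0 < L)%N -> psdmx (stR A C PP).
Proof.
move=> /stC_gram[B _ CE]; apply: psdmxD; first exact: psdmx_congr.
by rewrite CE; apply: psdmx_gram.
Qed.

Lemma stR_unit : (0 < L)%N -> stR A C PP \in unitmx.
Proof.
move=> /stC_gram[B Bu CE]; rewrite /stR CE.
by apply: psdD_gram_unit; [apply: psdmx_congr | rewrite row_free_unit].
Qed.

Lemma infocor_le_det : (0 < L)%N ->
  lemx (infocor A D C PP) (n%:R *: infodet A D C P).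
Proof.
move=> L_gt0; rewrite /infodet -hadamardmxZr; apply: Hmx_hadamard_le.
apply: blocktr_lemx => i; rewrite /lemx -(PP_diag i) -!blockselE.
rewrite -mulmxBl -mulmxBr; apply: psdmx_congr.
have pstC : psdmx (stC n C).
  by have [B _ ->] := stC_gram L_gt0; apply: psdmx_gram.
(* [stR A C PP] unfolds to [Rmx] of [stA n A], [stC n C] and [PP], so the spatial bound applies to
   the space-time model as it stands. *)
exact: signalinfo_le PP_psd pstC (stR_unit L_gt0).
Qed.

Lemma infoiid_le_cor : (0 < L)%N ->
  lemx (n%:R *: infoiid A D C P) (infocor A D C PP).
Proof.
move=> L_gt0; rewrite /infoiid -hadamardmxZr; apply: Hmx_hadamard_le.
apply: lemx_blocktr => i; rewrite -{1 2 3}(PP_diag i).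
apply: signalinfo_block_ge PP_psd C_psd _ (stR_psd L_gt0) (stR_unit L_gt0).
by rewrite PP_diag; apply: Rmx_unit.
Qed.

Lemma infoiid_psd : psdmx (infoiid A D C P).
Proof. by apply/Hmx_hadamard_psd/signalinfo_psd/Rmx_unit/Rmx_psd/P_psd. Qed.

Lemma infocor_psd : (0 < L)%N -> psdmx (infocor A D C PP).
Proof.
move=> L_gt0; apply: Hmx_hadamard_psd; apply: psdmx_sum => i.
rewrite -blockselE; apply: psdmx_congr.
exact: signalinfo_psd PP_psd (stR_psd L_gt0) (stR_unit L_gt0).
Qed.

(** Moving [n] inside the inverse gives all three bounds the common factor 1/2, leaving only
    information matrices to compare. *)
Lemma scaled_invmxE p (X : 'M[F]_p) : X \in unitmx ->
  (2 * n%:R)^-1 *: invmx X = 2^-1 *: invmx (n%:R *: X).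
Proof.
move=> Xu; rewrite invmxZ ?scalerA ?invfM // unitmxZ //.
by rewrite unitfE pnatr_eq0 -lt0n.
Qed.

Lemma CRB_order : (0 < L)%N ->
  infodet A D C P \in unitmx -> infocor A D C PP \in unitmx ->
  infoiid A D C P \in unitmx ->
  lemx (CRBdet n A D C P) (CRBcor A D C PP) /\
  lemx (CRBcor A D C PP) (CRBiid n A D C P).
Proof.
move=> L_gt0 det_unit cor_unit iid_unit.
have n_unit : (n%:R : F) \is a GRing.unit by rewrite unitfE pnatr_eq0 -lt0n.
have half_ge0 : 0 <= 2^-1 :> F by rewrite invr_ge0 ler0n.
rewrite /CRBdet /CRBcor /CRBiid !scaled_invmxE //; split; apply: lemxZ => //.
  apply: lemx_inv; rewrite ?unitmxZ //; first exact: infocor_psd.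
  exact: infocor_le_det.
apply: lemx_inv; rewrite ?unitmxZ //; last exact: infoiid_le_cor.
exact: psdmxZ (ler0n _ _) infoiid_psd.
Qed.

End CRBOrder.

Theorem theorem1 (R : realType) (L m n : nat)
    (m_gt0 : (0 < m)%N) (n_gt0 : (0 < n)%N) (m_lt_L : (m < L)%N)
    (Theta : set R) (a : R -> 'cV[R[i]]_L) (theta : 'I_m -> R)
    (Theta_open : open Theta) (a_smooth : smooth_on Theta a)
    (theta_in : forall i, Theta (theta i)) (theta_inj : injective theta)
    (A D : 'M[R[i]]_(L, m))
    (A_def : A = steeringmx a theta) (D_def : D = dsteeringmx a theta)
    (A_free : row_free A^T)
    (C : 'M[R[i]]_L) (C_posdef : posdefmx C)
    (PP : 'M[R[i]]_(n * m)) (PP_psd : psdmx PP)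
    (P : 'M[R[i]]_m) (PP_diag : forall i : 'I_n, blockmx PP i i = P)
    (det_unit : infodet A D C P \in unitmx)
    (cor_unit : infocor A D C PP \in unitmx)
    (iid_unit : infoiid A D C P \in unitmx) :
  lemx (CRBdet n A D C P) (CRBcor A D C PP) /\
  lemx (CRBcor A D C PP) (CRBiid n A D C P).
Proof.
exact: CRB_order n_gt0 A_free C_posdef PP_psd PP_diag (ltn_trans m_gt0 m_lt_L)
  det_unit cor_unit iid_unit.
Qed.
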